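(* Let $j\ge 3$ and $n,m\ge 2$ be integers. Then (1) if $n=2$ or $m=2$, then $m_j(S_n,S_m)=\left\lceil \dfrac{\max\{n,m\}-1}{j-1}\right\rceil$; (2) if $n,m\ge 3$ and $n+m-4=(j-1)s$ for some integer $s$, where $j$, $s$ and $n$ are all odd, then $m_j(S_n,S_m)=\left\lceil \dfrac{n+m-4}{j-1}\right\rceil$; (3) in all other cases, $m_j(S_n,S_m)=\left\lceil \dfrac{n+m-3}{j-1}\right\rceil$.
   Context: All graphs are simple (no loops or multiple edges). For positive integers $j,s$, $K_{j\times s}$ denotes the complete balanced multipartite graph with $j$ partite sets, each of size $s$ (two vertices are adjacent iff they lie in different partite sets). $S_n=K_{1,n-1}$ denotes the star on $n$ vertices. For graphs $G,H$, write $K_{j\times s}\rightarrow (G,H)$ if every colouring of the edges of $K_{j\times s}$ with two colours (red and blue) contains a red copy of $G$ or a blue copy of $H$ (copies are subgraphs, not necessarily induced). The size Ramsey multipartite number $m_j(G,H)$ is the smallest positive integer $s$ such that $K_{j\times s}\rightarrow (G,H)$. *)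

(* Defs.v *)
From mathcomp Require Import all_boot all_order all_algebra.
From mathcomp Require Import boolp classical_sets.

Set Implicit Arguments.
Unset Strict Implicit.
Unset Printing Implicit Defensive.

Record sgraph := SGraph {
  vertex :> finType;
  adj : rel vertex;
  adj_sym : symmetric adj;
  adj_irr : irreflexive adj }.

Section Multipartite.
Variables j s : nat.

Definition multipartite_rel : rel ('I_j * 'I_s) := fun u v => u.1 != v.1.

Lemma multipartite_sym : symmetric multipartite_rel.
Proof. by move=> u v; rewrite /multipartite_rel eq_sym. Qed.

Lemma multipartite_irr : irreflexive multipartite_rel.
Proof. by move=> u; rewrite /multipartite_rel eqxx. Qed.

Definition multipartite : sgraph := SGraph multipartite_sym multipartite_irr.
End Multipartite.

Section Bipartite.
Variables a b : nat.

Definition bipartite_rel : rel ('I_a + 'I_b) := fun u v =>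
  match u, v with
  | inl _, inr _ | inr _, inl _ => true
  | _, _ => false
  end.

Lemma bipartite_sym : symmetric bipartite_rel.
Proof. by case=> u [] v. Qed.

Lemma bipartite_irr : irreflexive bipartite_rel.
Proof. by case. Qed.

Definition complete_bipartite : sgraph := SGraph bipartite_sym bipartite_irr.
End Bipartite.

(* For n > 0; the vertex count is n, not the number of leaves. *)
Definition star (n : nat) : sgraph := complete_bipartite 1 n.-1.

(* A 2-colouring of the edges of K is a map c on sets of vertices of K; only
   its values on the unordered pairs {u, v} with u, v adjacent matter. *)
Section ColourClass.
Variables (K : sgraph) (c : {set K} -> bool) (b : bool).

Definition colour_rel : rel K := fun u v =>
  adj u v && (c [set u; v]%SET == b).

Lemma colour_sym : symmetric colour_rel.
Proof. by move=> u v; rewrite /colour_rel adj_sym finset.setUC. Qed.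

Lemma colour_irr : irreflexive colour_rel.
Proof. by move=> u; rewrite /colour_rel adj_irr. Qed.

Definition colour_class : sgraph := SGraph colour_sym colour_irr.
End ColourClass.

Definition has_copy (K G : sgraph) : Prop :=
  exists f : G -> K,
    injective f /\ forall x y : G, adj x y -> adj (f x) (f y).

(* [true] is red and [false] is blue. *)
Definition arrows (K G H : sgraph) : Prop :=
  forall c : {set K} -> bool,
    has_copy (colour_class c true) G \/ has_copy (colour_class c false) H.

Definition is_size_ramsey (j : nat) (G H : sgraph) (s : nat) : Prop :=
  [/\ (0 < s)%N, arrows (multipartite j s) G H
    & forall t : nat, (0 < t)%N -> arrows (multipartite j t) G H -> (s <= t)%N].

(* The number m_j(G, H).  The value 0 is taken exactly when no positive s
   satisfies K_{j x s} -> (G, H); so an equation m_j(G, H) = k with k > 0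
   includes the existence of such an s. *)
Definition size_ramsey (j : nat) (G H : sgraph) : nat :=
  xget 0%N [set s | is_size_ramsey j G H s]%classic.

(* Main.v *)
Require Import Defs.
From mathcomp Require Import all_boot all_order all_algebra.
From mathcomp Require Import zify.
From mathcomp Require classical_sets.
Import Order.TTheory GRing.Theory Num.Theory.
Local Open Scope ring_scope.

(** A copy of the star on n vertices is a vertex of degree at least n - 1.  So
    a colouring of K_{j x s} avoids both stars exactly when every red degree is
    at most n - 2 and every blue degree at most m - 2, while the two degrees at
    a vertex always add up to (j - 1) s.

    If (j - 1) s > n + m - 4 there is no room for such degrees.  If
    (j - 1) s = n + m - 4, the red graph must be (n - 2)-regular on j s
    vertices, which the handshake lemma forbids when j, s and n are all odd.
    In every other case a suitable colouring exists, because K_{j x s} has a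
    k-regular spanning subgraph for every k <= (j - 1) s with j s k even
    ([multipartite_regular_colouring]): take k = n - 2, or k = n - 3 if the
    parity is wrong, or colour everything red if n - 2 > (j - 1) s.

    The regular subgraphs imitate Cayley graphs.  On the vertex set
    Z_j x Z_s, each ordered pair of vertices gets a label in Z_j x Z_s such
    that v |-> label(u, v) is a bijection for every u, u and v are adjacent iff
    the first coordinate of the label is nonzero, and label(v, u) is the image
    of label(u, v) under a fixed involution ([edge_labelC]).  The pairs whose
    label lies in a set S of k such labels, stable under the involution, form a
    k-regular graph.  Among the (j - 1) s labels with nonzero first coordinate,
    stable sets of every even size exist, and of every odd size as soon as one
    of these labels is fixed ([stable_subset]), which is the case when j s is
    even ([fixed_proper_label]).

    This determines exactly which s satisfy the arrow relation
    ([arrows_multipartite_stars]), and the least one is read off as a ceiling.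
    Case (1) of the theorem obeys the general formula
    ceil((n + m - 3) / (j - 1)): the exceptional parities cannot occur when n
    or m is 2. *)

(** * Stars, degrees and colourings *)

Definition degree (G : sgraph) (u : G) : nat := #|[set v | adj u v]|.

Lemma has_copy_star (G : sgraph) (n : nat) :
  has_copy G (star n) <-> exists u : G, (n.-1 <= degree G u)%N.
Proof.
split=> [[f [f_inj f_adj]]|[u]].
  exists (f (inl ord0)).
  pose g (i : 'I_n.-1) := f (inr i).
  have g_inj : injective g by move=> i k /f_inj [].
  have card_g : #|codom g| = n.-1 by rewrite card_codom // card_ord.
  rewrite /degree; apply: leq_trans (eq_leq (esym card_g)) _.
  apply/subset_leq_card/subsetP.
  by move=> v /codomP [i ->]; rewrite inE f_adj.
rewrite /degree cardE => le_n.
pose nb (i : 'I_n.-1) := nth u (enum [set v | adj u v]) i.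
have nb_lt (i : 'I_n.-1) : (i < size (enum [set v | adj u v]))%N.
  exact: leq_trans le_n.
have adj_nb i : adj u (nb i).
  by have := mem_nth u (nb_lt i); rewrite mem_enum inE.
have nb_neq i : nb i <> u by move=> e; have := adj_nb i; rewrite e adj_irr.
exists (fun x => match x with inl _ => u | inr i => nb i end); split.
- case=> [x|x] [y|y] //=.
  + by rewrite (ord1 x) (ord1 y).
  + by move/esym/nb_neq.
  + by move/nb_neq.
  + move/eqP; rewrite nth_uniq ?enum_uniq // => /eqP xy.
    by congr inr; apply: val_inj.
- by case=> [x|x] [y|y] //= _; rewrite adj_sym.
Qed.

Lemma colour_degrees (K : sgraph) (c : {set K} -> bool) (u : K) :
  (degree (colour_class c true) u + degree (colour_class c false) u)%N
  = degree K u.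
Proof.
rewrite /degree -(cardsID [set v | c [set u; v]] [set v | adj u v]).
congr (_ + _)%N; apply: eq_card => v; rewrite !inE /= /colour_rel.
  by rewrite eqb_id.
by rewrite eqbF_neg andbC.
Qed.

(** A colouring is a map on sets of vertices; this lets the red graph be given
    by a symmetric relation instead. *)
Lemma colour_class_of_rel (K : sgraph) (r : rel K) :
    symmetric r -> (forall u v, r u v -> adj u v) ->
  exists c : {set K} -> bool,
    forall u v, adj u v -> c [set u; v] = r u v.
Proof.
move=> r_sym r_adj.
exists (fun A => [exists x, exists y, (A == [set x; y]) && r x y]).
move=> u v _; apply/idP/idP; last first.
  by move=> ruv; apply/existsP; exists u; apply/existsP; exists v; rewrite eqxx.
case/existsP=> x /existsP [y /andP [/eqP e rxy]].
have x_neq_y : x != y by apply: contraTneq (r_adj _ _ rxy) => ->; rewrite adj_irr.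
have: x \in [set u; v] by rewrite e set21.
have: y \in [set u; v] by rewrite e set22.
(* The two cases with x = y are excluded; the other two differ by symmetry *)
case/set2P=> ey /set2P [] ex; move: rxy x_neq_y; rewrite ex ey ?eqxx //.
by rewrite r_sym.
Qed.

(** Handshake lemma: ordering the vertices by [enum_rank] splits the ordered
    adjacent pairs into two halves that are exchanged by swapping. *)
Lemma sum_degree_even (G : sgraph) : ~~ odd (\sum_(u : G) degree G u).
Proof.
have -> : (\sum_(u : G) degree G u = \sum_(u : G) \sum_(v : G) adj u v)%N.
  apply: eq_bigr => u _; rewrite /degree -sum1_card big_mkcond /=.
  by apply: eq_bigr => v _; rewrite inE; case: (adj u v).
pose lt (u v : G) := (enum_rank u < enum_rank v)%N.
have -> : (\sum_(u : G) \sum_(v : G) adj u v =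
    \sum_(u : G) \sum_(v : G | lt u v) adj u v
    + \sum_(u : G) \sum_(v : G | lt v u) adj u v)%N.
  rewrite -big_split /=; apply: eq_bigr => u _.
  rewrite (bigID (lt u)) /=; congr (_ + _)%N.
  rewrite big_mkcond [RHS]big_mkcond /=; apply: eq_bigr => v _.
  rewrite /lt -leqNgt leq_eqVlt.
  case: eqP => [/val_inj/enum_rank_inj ->|_ //].
  by rewrite adj_irr; case: ifP.
have -> : (\sum_(u : G) \sum_(v : G | lt v u) adj u v
         = \sum_(u : G) \sum_(v : G | lt u v) adj u v)%N.
  rewrite (exchange_big_dep xpredT) //=.
  by apply: eq_bigr => u _; apply: eq_bigr => v _; rewrite adj_sym.
by rewrite addnn odd_double.
Qed.

(** * Regular spanning subgraphs of complete multipartite graphs *)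

(** Induction on k in steps of two: if f moves some x in D, the orbit {x, f x}
    is set aside for S and removed from D; if not, every subset of D is stable.
    For odd k the induction ends with k = 1, where a fixed point is needed; the
    given one is still there, since it lies in no orbit of size 2. *)
Lemma stable_subset (T : finType) (f : T -> T) (k : nat) (D : {set T}) :
    involutive f -> (forall x, x \in D -> f x \in D) -> (k <= #|D|)%N ->
    ~~ odd k \/ (exists2 x, x \in D & f x = x) ->
  exists S : {set T},
    [/\ S \subset D, #|S| = k & forall x, x \in S -> f x \in S].
Proof.
move=> fK; elim/ltn_ind: k D => -[|[|k]] IH D D_st le_k fix_or.
- by exists set0; rewrite sub0set cards0; split=> // x; rewrite !inE.
- case: fix_or => [//|[x xD fx]]; exists [set x].
  by rewrite sub1set cards1; split=> // y; rewrite !inE => /eqP ->; rewrite fx.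
case: (pickP [pred x in D | f x != x]) => [x /andP [/= xD fx]|allfix]; last first.
  have f_id x : x \in D -> f x = x.
    by move=> xD; apply/eqP; have /negbT := allfix x; rewrite /= xD negbK.
  pose S := [set x in take k.+2 (enum D)].
  have SD x : x \in S -> x \in D by rewrite inE => /mem_take; rewrite mem_enum.
  exists S; split; first exact/subsetP.
  - rewrite cardsE (card_uniqP _) ?take_uniq ?enum_uniq //.
    by rewrite size_takel // -cardE.
  - by move=> x xS; rewrite f_id // SD.
pose P := [set x; f x].
have card_P : #|P| = 2%N by rewrite cards2 eq_sym fx.
have PD : P \subset D by apply/subsetP=> y /set2P [] ->; rewrite ?D_st.
have P_st y : (f y \in P) = (y \in P).
  by rewrite !inE (inj_eq (inv_inj fK)) (can2_eq fK fK) orbC.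
have [|||S [SD' card_S S_st]] := IH k (leqnSn _) (D :\: P).
- by move=> y; rewrite !in_setD P_st => /andP [-> /D_st].
- by move: (cardsID P D); rewrite (setIidPr PD) card_P; lia.
- case: fix_or => [|[y yD fy]]; first by rewrite /= negbK; left.
  right; exists y => //; rewrite in_setD yD andbT !inE negb_or.
  apply/andP; split; apply: contraNneq fx => yx; first by rewrite -yx fy.
  by rewrite -{2}[x]fK -yx fy.
have /subsetDP [SD SP] := SD'.
exists (S :|: P); split; first by rewrite subUset SD.
  have : #|S :&: P| = 0%N by apply/eqP; rewrite cards_eq0 setI_eq0.
  by move: (cardsUI S P); rewrite card_P card_S; lia.
by move=> y; rewrite !(in_setU, P_st) => /orP [/S_st ->|->]; rewrite ?orbT.
Qed.

(** Here and below j = p + 1 and s = q + 1, so that the index types are the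
    groups Z_j and Z_s.  The sum in the second coordinate is symmetric in u and
    v.  The difference in the first one is antisymmetric, so that for odd j
    no label with nonzero first coordinate would be fixed; for even s it is
    therefore multiplied by the sign (-1) ^ u.2.  When u.2 + v.2 is odd, the
    signs of u and v differ and the first coordinate becomes symmetric too. *)
Definition edge_label {p q : nat} (u v : 'I_p.+1 * 'I_q.+1) : 'I_p.+1 * 'I_q.+1 :=
  (if odd q && odd u.2 then u.1 - v.1 else v.1 - u.1, u.2 + v.2).

(** The effect on labels of exchanging the two endpoints. *)
Definition flip_label {p q : nat} (l : 'I_p.+1 * 'I_q.+1) : 'I_p.+1 * 'I_q.+1 :=
  (if odd q && odd l.2 then l.1 else - l.1, l.2).

Lemma flip_labelK {p q : nat} : involutive (@flip_label p q).
Proof. by case=> a b; rewrite /flip_label /=; case: (odd q && odd b); rewrite /= ?opprK. Qed.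

Lemma edge_labelC {p q : nat} (u v : 'I_p.+1 * 'I_q.+1) :
  edge_label v u = flip_label (edge_label u v).
Proof.
rewrite /edge_label /flip_label /= [v.2 + u.2]addrC.
case odd_q: (odd q) => /=; last by rewrite opprB.
(* s = q + 1 is even, so parity is well defined modulo s *)
rewrite odd_mod ?oddD /= ?odd_q //.
by case: (odd u.2); case: (odd v.2); rewrite /= ?opprB.
Qed.

Lemma edge_label_bij {p q : nat} (u : 'I_p.+1 * 'I_q.+1) : bijective (edge_label u).
Proof.
apply: injF_bij => -[a b] [a' b']; rewrite /edge_label /= => /eqP.
rewrite xpair_eqE (inj_eq (addrI _)) => /andP [+ /eqP ->].
by case: ifP => _; rewrite ?(inj_eq (addrI _)) ?(inj_eq oppr_inj) ?(inj_eq (addIr _)) => /eqP ->.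
Qed.

Lemma edge_label_eq0 {p q : nat} (u v : 'I_p.+1 * 'I_q.+1) :
  ((edge_label u v).1 == 0) = (u.1 == v.1).
Proof. by rewrite /edge_label /=; case: ifP; rewrite subr_eq0 // eq_sym. Qed.

Definition proper_labels (p q : nat) : {set 'I_p.+1 * 'I_q.+1} := [set l | l.1 != 0].

Lemma card_proper_labels (p q : nat) : #|proper_labels p q| = (p * q.+1)%N.
Proof.
have -> : proper_labels p q = setX [set~ 0] [set: 'I_q.+1].
  by apply/setP => -[a b]; rewrite !inE andbT.
by rewrite cardsX cardsC1 cardsT !card_ord.
Qed.

(** If s is even, every label with odd second coordinate is fixed.  Otherwise
    j is even, and the element j / 2 of Z_j is its own opposite. *)
Lemma fixed_proper_label (p q : nat) :
    (0 < p)%N -> ~~ odd (p.+1 * q.+1) ->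
  exists2 l, l \in proper_labels p q & flip_label l = l.
Proof.
move=> p_gt0; rewrite oddM negb_and /= !negbK /flip_label.
case odd_q: (odd q) => /= odd_p.
  have q_gt0 : (0 < q)%N by case: q odd_q.
  exists (inord 1, inord 1); last by rewrite /= inordK.
  by rewrite inE /= -val_eqE /= inordK.
rewrite orbF in odd_p.
have [h half_p] : exists h, (h + h = p.+1)%N.
  by exists p.+1./2; rewrite addnn even_halfK //= negbK.
exists (inord h, 0).
  by rewrite inE /= -val_eqE /= inordK; lia.
congr (_, _); apply/eqP; rewrite /= eq_sym -subr_eq0 opprK -val_eqE /=.
by rewrite inordK; [rewrite half_p modnn | lia].
Qed.

Lemma multipartite_degree (p q : nat) (u : multipartite p.+1 q.+1) :
  degree (multipartite p.+1 q.+1) u = (p * q.+1)%N.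
Proof.
rewrite -card_proper_labels /degree.
rewrite -[RHS](on_card_preimset (onW_bij _ (edge_label_bij u))).
by apply: eq_card => v; rewrite !inE edge_label_eq0.
Qed.

(** The red graph consists of the pairs whose label lies in a flip-stable set
    of k proper labels. *)
Lemma multipartite_regular_colouring (p q k : nat) :
    (0 < p)%N -> (k <= p * q.+1)%N -> ~~ (odd k && odd (p.+1 * q.+1)) ->
  exists c : {set multipartite p.+1 q.+1} -> bool, forall u,
    degree (colour_class c true) u = k
    /\ degree (colour_class c false) u = (p * q.+1 - k)%N.
Proof.
move=> p_gt0 le_k parity.
have [|||S [SD card_S S_st]] := stable_subset _ _ k (proper_labels p q) (flip_labelK).
- by move=> [a b]; rewrite !inE /=; case: ifP; rewrite ?oppr_eq0.
- by rewrite card_proper_labels.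
- by case: (boolP (odd k)) parity => [_ /= /fixed_proper_label|_ _]; auto.
have [|u v Suv|c c_r] := colour_class_of_rel (multipartite p.+1 q.+1)
    (fun u v => edge_label u v \in S).
- move=> u v; rewrite [edge_label v u]edge_labelC; apply/idP/idP => /S_st //.
  by rewrite flip_labelK.
- by have := subsetP SD _ Suv; rewrite inE edge_label_eq0.
exists c => u.
suff red_k : degree (colour_class c true) u = k.
  split=> //; have := colour_degrees _ c u.
  by rewrite red_k multipartite_degree => <-; rewrite addKn.
rewrite -card_S -[RHS](on_card_preimset (onW_bij _ (edge_label_bij u))) /degree.
apply: eq_card => v.
transitivity ((u.1 != v.1) && c [set u; v]); first by rewrite inE /= /colour_rel eqb_id.
rewrite inE; case: eqP => [uv|/eqP uv]; last exact: c_r.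
apply/esym/negbTE/negP => /(subsetP SD).
by rewrite inE edge_label_eq0 uv eqxx.
Qed.

(** * The arrow relation and the Ramsey numbers *)

(** The exact range of s: either the degree (j - 1) s exceeds
    (n - 2) + (m - 2), or it is equal to it and parity rules out the only
    possible red degree n - 2. *)
Lemma arrows_multipartite_stars (p q n m : nat) :
    (0 < p)%N -> (2 <= n)%N -> (2 <= m)%N ->
  arrows (multipartite p.+1 q.+1) (star n) (star m) <->
  (n + m < p * q.+1 + 4)%N
  || [&& n + m == p * q.+1 + 4, odd p.+1, odd q.+1 & odd n]%N.
Proof.
move=> p_gt0 n_ge2 m_ge2; split=> [arr|large c].
  apply: contraT; rewrite negb_or -leqNgt => /andP [le_N not_tight].
  have [k [le_k lt_n lt_m parity]] : exists k, [/\ k <= p * q.+1, k < n.-1,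
      p * q.+1 - k < m.-1 & ~~ (odd k && odd (p.+1 * q.+1))]%N.
    (* All red if n - 2 is at least the degree; else n - 2, or n - 3 when n
       and the number of vertices are odd: then the degree p * q.+1 is even,
       and it is smaller than n + m - 4 *)
    have : (p * q.+1 <= n - 2 \/ n - 2 < p * q.+1)%N by lia.
    have oddN : odd (p * q.+1) = odd p && odd q.+1 by rewrite oddM.
    have oddV : odd (p.+1 * q.+1) = odd p.+1 && odd q.+1 by rewrite oddM.
    move: oddN oddV not_tight le_N.
    move: (p * q.+1)%N (p.+1 * q.+1)%N => N V oddN oddV not_tight le_N.
    case=> [le_Nn|lt_nN]; first by exists N; split; lia.
    case: (boolP (odd n && odd V)) => oddnV; last by exists (n - 2)%N; split; lia.
    by exists (n - 3)%N; split; lia.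
  have [c deg_c] := multipartite_regular_colouring p q k p_gt0 le_k parity.
  case: (arr c) => /has_copy_star [u]; have [red_k blue_k] := deg_c u.
    by rewrite red_k leqNgt lt_n.
  by rewrite blue_k leqNgt lt_m.
case: (boolP [exists u, n.-1 <= degree (colour_class c true) u]%N) => [/existsP red|].
  by left; apply/has_copy_star.
rewrite negb_exists => /forallP no_red; right; apply/has_copy_star/existsP.
apply: contraLR large; rewrite negb_exists => /forallP no_blue.
have deg_c u : [/\ (degree (colour_class c true) u <= n - 2)%N,
    (degree (colour_class c false) u <= m - 2)%N &
    (degree (colour_class c true) u + degree (colour_class c false) u = p * q.+1)%N].
  have := colour_degrees _ c u; rewrite multipartite_degree => sum_deg.
  by have := no_red u; have := no_blue u; split=> //; lia.
have N_le : (p * q.+1 + 4 <= n + m)%N.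
  by have [] := deg_c (ord0, ord0); lia.
rewrite negb_or -leqNgt N_le; apply/negP => /and4P [/eqP tight odd_p odd_q odd_n].
have := sum_degree_even (colour_class c true).
have deg_red u : degree (colour_class c true) u = (n - 2)%N.
  by have [] := deg_c u; lia.
rewrite (eq_bigr _ (fun u _ => deg_red u)) sum_nat_const card_prod !card_ord !oddM.
by rewrite odd_p odd_q /= oddB ?odd_n.
Qed.

Lemma size_ramsey_eq (j s : nat) (G H : sgraph) :
    (0 < s)%N -> arrows (multipartite j s) G H ->
    (forall t, (0 < t < s)%N -> ~ arrows (multipartite j t) G H) ->
  size_ramsey j G H = s.
Proof.
move=> s_gt0 arr_s no_t.
have s_ramsey : is_size_ramsey j G H s.
  split=> // t t_gt0 arr_t; rewrite leqNgt; apply/negP => lt_ts.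
  by apply: (no_t t); rewrite ?t_gt0.
apply: classical_sets.xget_unique => // t [t_gt0 arr_t min_t].
case: s_ramsey => _ _ min_s.
by apply/eqP; rewrite eqn_leq min_s // min_t.
Qed.

Lemma ceil_natr_div (a p s : nat) :
    (0 < p)%N -> (p * s < a + p)%N -> (a <= p * s)%N ->
  Num.ceil (a%:R / p%:R : rat) = s%:Z.
Proof.
move=> p_gt0 lt_a le_a; apply: ceil_def.
have p_gt0' : 0 < p%:R :> rat by rewrite ltr0n.
rewrite ltr_pdivlMr // ler_pdivrMr // intrB -!pmulrn.
rewrite mulrBl mul1r ltrBlDr -!natrM -natrD ltr_nat ler_nat [(s * p)%N]mulnC.
by rewrite lt_a.
Qed.

(** The bound on p * s says that the degree for s - 1 is at most n + m - 4.
    Hence a smaller number of vertices per part could only arrow by parity,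
    which the last hypothesis excludes. *)
Lemma size_ramsey_stars (p n m s : nat) :
    (0 < p)%N -> (2 <= n)%N -> (2 <= m)%N -> (0 < s)%N ->
    (p * s < n + m + p - 3)%N ->
    (n + m < p * s + 4)%N
      || [&& n + m == p * s + 4, odd p.+1, odd s & odd n]%N ->
    (forall t, (t < s)%N ->
      ~ [/\ (n + m = p * t + 4)%N, odd p.+1, odd t & odd n]) ->
  size_ramsey p.+1 (star n) (star m) = s.
Proof.
move=> p_gt0 n_ge2 m_ge2 s_gt0 s_least s_large no_tight; apply: size_ramsey_eq => //.
  case: s s_gt0 s_large {s_least no_tight} => // q _.
  by move/(arrows_multipartite_stars _ q _ _ p_gt0 n_ge2 m_ge2).
case=> // q /= lt_qs /(arrows_multipartite_stars _ q _ _ p_gt0 n_ge2 m_ge2).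
have le_qs : (p * q.+1 + p <= p * s)%N by rewrite -mulnSr leq_mul2l lt_qs orbT.
case/orP=> [|/and4P [/eqP tight odd_p odd_q odd_n]]; first by lia.
exact: (no_tight q.+1).
Qed.

Theorem theorem8 (j n m : nat) (hj : (3 <= j)%N) (hn : (2 <= n)%N) (hm : (2 <= m)%N) :
  let case1 := n = 2%N \/ m = 2%N in
  let case2 := [/\ (3 <= n)%N, (3 <= m)%N &
    exists s : nat,
      [/\ (n + m - 4 = (j - 1) * s)%N, odd j, odd s & odd n]] in
  [/\ case1 ->
        (size_ramsey j (star n) (star m))%:Z =
          Num.ceil (((maxn n m)%:R - 1) / (j%:R - 1) : rat),
      case2 ->
        (size_ramsey j (star n) (star m))%:Z =
          Num.ceil ((n%:R + m%:R - 4) / (j%:R - 1) : rat)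
    & ~ case1 -> ~ case2 ->
        (size_ramsey j (star n) (star m))%:Z =
          Num.ceil ((n%:R + m%:R - 3) / (j%:R - 1) : rat)].
Proof.
move=> case1 case2.
case: j hj @case2 => // p p_ge2 case2; have p_gt0 : (0 < p)%N by lia.
have -> : p.+1%:R - 1 = p%:R :> rat by rewrite -natr1 addrK.
(* The three cases differ only in whether some s attains the parity obstruction *)
have generic : (forall t, ~ [/\ (n + m = p * t + 4)%N, odd p.+1, odd t & odd n]) ->
    (size_ramsey p.+1 (star n) (star m))%:Z =
      Num.ceil ((n + m - 3)%:R / p%:R : rat).
  move=> no_tight.
  have [s [s_gt0 s_lt s_gt]] : exists s,
      [/\ 0 < s, p * s <= n + m - 4 + p & n + m - 4 < p * s]%N.
    exists ((n + m - 4) %/ p).+1; split=> //.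
      by rewrite mulnSr leq_add2r mulnC leq_trunc_div.
    by rewrite mulnC ltn_ceil.
  rewrite (ceil_natr_div _ _ s); [|by lia..].
  congr Posz; apply: size_ramsey_stars => //; by lia.
split=> [small|[n_ge3 m_ge3 [s [tight odd_p odd_s odd_n]]]|big not2].
- have -> : (maxn n m)%:R - 1 = (n + m - 3)%:R :> rat.
    have -> : maxn n m = (n + m - 3).+1 by case: small => ->; lia.
    by rewrite -natr1 addrK.
  apply: generic => t [tight odd_p odd_t odd_n].
  case: small => [n2|m2]; first by rewrite n2 in odd_n.
  (* m = 2 makes n = p * t + 2, which is even as p = j - 1 is *)
  have : ~~ odd (p * t) by rewrite oddM negb_and; move: odd_p => /= ->.
  by lia.
- have -> : n%:R + m%:R - 4 = (n + m - 4)%:R :> rat by rewrite natrB ?natrD //; lia.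
  rewrite subn1 /= in tight; have s_gt0 : (0 < s)%N by case: s odd_s {tight}.
  rewrite (ceil_natr_div _ _ s); [|by lia..].
  congr Posz; apply: size_ramsey_stars => //; try by lia.
  by move=> t lt_ts [tight_t _ _ _]; nia.
- have -> : n%:R + m%:R - 3 = (n + m - 3)%:R :> rat by rewrite natrB ?natrD //; lia.
  apply: generic => t [tight odd_p odd_t odd_n]; apply: not2.
  have [n2 m2] : n <> 2 /\ m <> 2 by split=> e; apply: big; [left|right].
  by split; [lia|lia|exists t; split=> //; lia].
Qed.
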